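(* Let $n\geq 4$ be an even integer and let $G$ be a simple connected graph on $n$ vertices. Let $r(n)$ denote the largest root of the equation $x^3-(3n-7)x^2+n(2n-7)x-2(n^2-7n+12)=0$. If \[ q_1(G)>\begin{cases} r(n), & \text{for } n\geq 10 \text{ or } n=4,\\ 4+2\sqrt{3}, & \text{for } n=6,\\ 6+2\sqrt{6}, & \text{for } n=8,\end{cases} \] then $G$ has a perfect matching.
   Context: For a simple graph $G$, the signless Laplacian matrix is $Q(G)=D(G)+A(G)$, where $D(G)$ is the diagonal matrix of vertex degrees and $A(G)$ is the adjacency matrix of $G$. The signless Laplacian spectral radius $q_1(G)$ is the largest eigenvalue of $Q(G)$. A perfect matching is a set of pairwise disjoint edges covering all vertices. *)

(* Defs.v *)
From mathcomp Require Import all_boot all_order all_algebra.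
From mathcomp Require Import classical_sets reals.
Set Implicit Arguments.
Unset Strict Implicit.
Unset Printing Implicit Defensive.
Import Order.TTheory GRing.Theory Num.Theory.
Local Open Scope ring_scope.

Record sgraph (n : nat) := SGraph {
  adj :> rel 'I_n;
  adj_sym : symmetric adj;
  adj_irr : irreflexive adj
}.

Definition connected n (G : sgraph n) : Prop := forall u v, connect G u v.

Definition edges n (G : sgraph n) : {set {set 'I_n}} :=
  [set [set p.1; p.2]%SET | p in [pred p : 'I_n * 'I_n | G p.1 p.2]]%SET.

Definition perfect_matching n (G : sgraph n) (M : {set {set 'I_n}}) : bool :=
  [&& M \subset edges G, finset.trivIset M & finset.cover M == [set: 'I_n]%SET].

Definition degree n (G : sgraph n) (u : 'I_n) : nat := #|[pred v | G u v]|.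

Definition degree_mx (R : realType) n (G : sgraph n) : 'M[R]_n :=
  diag_mx (\row_u (degree G u)%:R).

Definition adjacency_mx (R : realType) n (G : sgraph n) : 'M[R]_n :=
  \matrix_(u, v) (G u v)%:R.

Definition signless_laplacian (R : realType) n (G : sgraph n) : 'M[R]_n :=
  degree_mx R G + adjacency_mx R G.

(* The default value 0 is returned only when A has no greatest element, which
   does not happen for the spectrum of a nonempty symmetric real matrix nor for
   the roots of a real cubic. *)
Definition largest (R : realType) (A : set R) : R :=
  xget 0 [set x | A x /\ forall y, A y -> y <= x]%classic.

Definition q1 (R : realType) n (G : sgraph n) : R :=
  largest [set x | eigenvalue (signless_laplacian R G) x]%classic.

Definition r (R : realType) (n : nat) : R :=
  largest [set x | x ^+ 3 - (3 * n%:R - 7) * x ^+ 2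
                   + n%:R * (2 * n%:R - 7) * x
                   - 2 * (n%:R ^+ 2 - 7 * n%:R + 12) = 0]%classic.

(* Main.v *)
(** Let G have no perfect matching and let H be an edge-maximal graph without
    perfect matching containing G; write S for the vertices joined in H to all
    others and s for their number.  By Lovasz's exchange argument H - S is a
    disjoint union of cliques.  Adding a missing edge ac to H gives a perfect
    matching f through ac; the points a, c and the f-partners of S lie in s + 2
    distinct cliques, and s > 0 by connectivity.  Hence every clique has at most
    M = n - 2s - 1 vertices.

    If x > 0 and Q(G) x <= rho x entrywise, then q_1(G) <= rho.  Take x = 1 on S
    and x = s / (rho - s + 2 - 2m) on a clique of size m, so that equality holds
    off S for H.  By convexity in m the condition on S is implied by the one for
    the join of K_s with K_M and s + 1 isolated vertices, namely
      s ((s + 1) / (rho - s) + M / (rho - s + 2 - 2M)) <= rho - (n - 2 + s).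
    For s = 1 and rho = r(n) it is the cubic equation; for s > 1 and n >= 10 the
    bound r(n) >= 2n - 6 suffices, except that (n, s) = (10, 4) needs
    r(10) >= 43/3; for n = 6 and n = 8 the extremal cases are s = 2 and s = 3. *)

Require Import Defs.
From mathcomp Require Import all_boot all_order all_algebra.
From mathcomp Require Import boolp.
From mathcomp Require Import reals perm.
From mathcomp Require Import zify ring lra.
Set Implicit Arguments.
Unset Strict Implicit.
Unset Printing Implicit Defensive.
Import Order.TTheory GRing.Theory Num.Theory.

(** * Perfect matchings as involutions, and exchange along alternating walks *)

Section Factor.
Variable T : finType.
Implicit Types (e : rel T) (f : T -> T) (a b c d p q x y : T).

(** For irreflexive [e] such an [f] has no fixed point: it encodes a perfect matching by sending
    each point to its partner. *)
Definition factor e f := involutive f /\ forall x, e x (f x).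

(** For distinct [a] and [c]: a perfect matching of [e] enlarged by the edge [a c], using that
    edge. *)
Definition near_factor e a c f :=
  [/\ involutive f, f a = c & forall x, x != a -> x != c -> e x (f x)].

Definition universal e : {set T} := [set x | [forall y, (y != x) ==> e x y]].

Lemma universalP e x : reflect (forall y, y != x -> e x y) (x \in universal e).
Proof.
rewrite inE; apply: (iffP forallP) => [h y|h y]; first exact/implyP/h.
by apply/implyP/h.
Qed.

(** Conjugation by a transposition: two disjoint pairs [p, f p] and [q, f q] become [p, q] and
    [f p, f q]. *)
Definition switch f p q x := tperm (f p) q (f (tperm (f p) q x)).

Lemma switchK f p q : involutive f -> involutive (switch f p q).
Proof. by move=> fK x; rewrite /switch tpermK fK tpermK. Qed.

Lemma switchE f p q : involutive f -> f p != p -> f q != q ->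
  q != p -> q != f p ->
  [/\ switch f p q p = q, switch f p q q = p, switch f p q (f p) = f q,
      switch f p q (f q) = f p &
      forall x, x != p -> x != q -> x != f p -> x != f q ->
        switch f p q x = f x].
Proof.
move=> fK fp fq qp qfp.
have inj := inv_inj fK.
have fqfp : f q != f p by rewrite (inj_eq inj).
have fqp : f q != p by apply: contraNneq qfp => <-; rewrite fK.
have E1 : switch f p q p = q by rewrite /switch (@tpermD _ _ _ p) ?tpermL.
have E2 : switch f p q (f p) = f q.
  by rewrite /switch tpermL tpermD // 1?eq_sym.
split=> //.
- by rewrite -{2}E1 switchK.
- by rewrite -E2 switchK.
move=> x xp xq xfp xfq; rewrite /switch (_ : tperm (f p) q x = x); last first.
  by rewrite tpermD // eq_sym.
rewrite tpermD // eq_sym; first by rewrite (inj_eq inj).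
by apply: contraNneq xfq => <-; rewrite fK.
Qed.

Section SymmetricRelation.
Variable e : rel T.
Hypotheses (e_sym : symmetric e) (e_irr : irreflexive e).

(* In the alternating walk [d, f1 d, f2 (f1 d), ...] a point at even distance
   never returns to its origin through an [f1] edge. *)
Lemma alternating_walk f1 f2 k x : involutive f1 -> involutive f2 ->
  (forall y, f1 y != y) -> (forall y, f2 y != y) ->
  f1 (iter k (f2 \o f1) x) != x.
Proof.
move=> f1K f2K n1 n2; elim/ltn_ind: k x => -[|[|k]] IH x //=.
  apply/eqP => E; have := n2 (f1 x); rewrite -{2}E f1K eqxx //.
apply/eqP => E; suff : f1 (iter k (f2 \o f1) (f2 (f1 x))) == f2 (f1 x).
  by apply/negP/IH; lia.
apply/eqP.
rewrite -[f2 (f1 x) in LHS]/((f2 \o f1) x) -iterSr iterS /=.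
by rewrite -{2}E !f1K f2K.
Qed.

Lemma near_factor_sym a c f : near_factor e a c f -> near_factor e c a f.
Proof.
by case=> fK fa fe; split=> // [|x xc xa]; [rewrite -fa fK | apply: fe].
Qed.

Lemma near_factor_neq a c f x : a != c -> near_factor e a c f -> f x != x.
Proof.
move=> ac [fK fa fe]; have [->|xa] := eqVneq x a; first by rewrite fa eq_sym.
have [->|xc] := eqVneq x c; first by rewrite -fa fK fa.
by apply/eqP => E; have := fe x xa xc; rewrite E e_irr.
Qed.

Lemma near_factor_avoid a c f x : near_factor e a c f ->
  x != a -> x != c -> (f x != a) /\ (f x != c).
Proof.
move=> [fK fa _] xa xc; split; [apply: contraNneq xc|apply: contraNneq xa].
  by move=> E; rewrite -fa -E fK.
by rewrite -fa => /(inv_inj fK) ->.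
Qed.

Section Exchange.
Variables (a b c d : T) (f1 f2 : T -> T).
Hypotheses (F1 : near_factor e a c f1) (F2 : near_factor e b d f2).
Hypotheses (ac : a != c) (bd : b != d).
Hypotheses (ba : b != a) (bc : b != c) (da : d != a) (dc : d != c).

Let f1K : involutive f1. Proof. by case: F1. Qed.
Let f2K : involutive f2. Proof. by case: F2. Qed.
Let f1n x : f1 x != x. Proof. exact: near_factor_neq F1. Qed.
Let f2n x : f2 x != x. Proof. exact: near_factor_neq F2. Qed.
Let f2b : f2 b = d. Proof. by case: F2. Qed.
Let f2d : f2 d = b. Proof. by rewrite -f2b f2K. Qed.
Let f1a : f1 a = c. Proof. by case: F1. Qed.
Let g i := iter i (f2 \o f1) d.

Let gS i : g i.+1 = f2 (f1 (g i)). Proof. by []. Qed.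

Let hits i := (g i == a) || (g i == c).

(** The walk sweeps out a set closed under [f1] and [f2] that contains [b] and [d] but neither [a]
    nor [c]; [f1] on it and [f2] off it avoid both exceptional pairs. *)
Lemma exchange_avoid : (forall i, ~~ hits i) -> exists f, factor e f.
Proof.
move=> nohit.
pose X x := `[< exists i, x = g i \/ x = f1 (g i) >].
have X1 x : X x -> X (f1 x).
  by move=> /asboolP[i [->|->]]; apply/asboolP; exists i;
    rewrite ?f1K; [right|left].
(* [f2 \o f1] permutes a finite set, so the walk returns to [d]; this closes [X] under [f2] at its
   origin. *)
have gper : exists i, d = g i.+1.
  have inj : injective (f2 \o f1).
    by apply: inj_comp; [apply: inv_inj f2K|apply: inv_inj f1K].
  exists (order (f2 \o f1) d).-1.
  rewrite /g prednK ?order_gt0 //; exact/esym/iter_order.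
have X2 x : X x -> X (f2 x).
  move=> /asboolP[i [->|->]]; apply/asboolP; last by exists i.+1; left.
  case: i => [|i].
    by have [i E] := gper; exists i; right; rewrite {1}/g /= E gS f2K.
  by exists i; right; rewrite gS f2K.
have X1E x : X (f1 x) = X x.
  by apply/idP/idP=> [/X1|/X1 //]; rewrite f1K.
have X2E x : X (f2 x) = X x.
  by apply/idP/idP=> [/X2|/X2 //]; rewrite f2K.
have Xac x : X x -> (x != a) /\ (x != c).
  move=> /asboolP[i ixE].
  have := nohit i; rewrite negb_or => /andP[ia ic].
  by case: ixE => ->; [|apply: near_factor_avoid F1 _ _].
have Xd : X d by apply/asboolP; exists 0%N; left.
have Xb : X b by rewrite -X2E f2b.
exists (fun x => if X x then f1 x else f2 x); split=> x.
  case: (boolP (X x)) => Xx; first by rewrite X1E Xx f1K.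
  by rewrite X2E (negbTE Xx) f2K.
case: ifPn => Xx.
  by have [xa xc] := Xac x Xx; case: F1 => _ _; apply.
by case: F2 => _ _; apply; apply: contraNneq Xx => ->.
Qed.

(** Let [Y] be the walk up to its first hit, at [a]. It is closed under [f1], and with [a] and [b]
    adjoined it is closed under [f2]; so [f1] on [Y], the pair [a b] and [f2] elsewhere fit
    together. *)
Lemma exchange_hit k : e a b -> g k = a -> (forall i, (i < k)%N -> ~~ hits i) ->
  exists f, factor e f.
Proof.
move=> eab gk nohit.
have k0 : (0 < k)%N by case: k gk {nohit} => // /eqP; rewrite /g /= (negbTE da).
pose Y x := `[< exists2 i, (i < k)%N & x = g i \/ x = f1 (g i) >].
have Y1 x : Y x -> Y (f1 x).
  by move=> /asboolP[i ik [->|->]]; apply/asboolP; exists i;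
    rewrite ?f1K //; [right|left].
have Y1E x : Y (f1 x) = Y x.
  by apply/idP/idP=> [/Y1|/Y1 //]; rewrite f1K.
have Yac x : Y x -> (x != a) /\ (x != c).
  move=> /asboolP[i ik ixE].
  have := nohit i ik; rewrite negb_or => /andP[ia ic].
  by case: ixE => ->; [|apply: near_factor_avoid F1 _ _].
have nYa : ~~ Y a by apply/negP => /Yac[]; rewrite eqxx.
have Yd : Y d by apply/asboolP; exists 0%N => //; left.
have nYb : ~~ Y b.
  (* If [b = g i.+1] then [f1 (g i) = d], against [alternating_walk]; if [b = f1 (g i)] then
     [g i.+1 = d], and by periodicity [a] is hit before time [k]. *)
  apply/negP => /asboolP[i ik [E|E]].
    case: i ik E => [|i] ik; first by move/eqP; rewrite /g /= (negbTE bd).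
    move/(congr1 f2); rewrite f2b gS f2K => E.
    by have := alternating_walk i d f1K f2K f1n f2n; rewrite -E eqxx.
  move/(congr1 f2): E; rewrite f2b -gS => E.
  have ik' : (i.+1 < k)%N.
    rewrite ltn_neqAle ik andbT; apply: contraNneq da => E'.
    by rewrite -gk -E' -E.
  have : hits (k - i.+1).
    by rewrite /hits -gk /g -{2}(subnK ik) iterD -/(g i.+1) -E eqxx.
  by apply/negP/nohit; lia.
have YZ x : Y x || (x == a) || (x == b) -> Y (f2 x) || (f2 x == a) || (f2 x == b).
  move=> /orP[/orP[/asboolP[i ik [->|->]]|/eqP->]|/eqP->].
  - case: i ik => [|i] ik; first by rewrite {3}/g /= f2d eqxx orbT.
    suff -> : Y (f2 (g i.+1)) by [].
    by apply/asboolP; exists i; [lia|right; rewrite gS f2K].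
  - rewrite -gS; have [->|ik'] := eqVneq i.+1 k; first by rewrite gk eqxx orbT.
    suff -> : Y (g i.+1) by [].
    by apply/asboolP; exists i.+1; [lia|left].
  - rewrite -gk; case: k k0 {gk nohit Y1 Y1E Yac nYa Yd nYb} @Y => // k _ Y.
    suff -> : Y (f2 (g k.+1)) by [].
    by apply/asboolP; exists k => //; right; rewrite gS f2K.
  - by rewrite f2b Yd.
have YZE x : Y (f2 x) || (f2 x == a) || (f2 x == b) = Y x || (x == a) || (x == b).
  by apply/idP/idP=> [/YZ|/YZ //]; rewrite f2K.
exists (fun x => if Y x then f1 x else if x == a then b else
                 if x == b then a else f2 x); split=> x.
  case: (boolP (Y x)) => Yx; first by rewrite Y1E Yx f1K.
  have [->|xa] := eqVneq x a; first by rewrite (negbTE nYb) (negbTE ba) eqxx.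
  have [->|xb] := eqVneq x b; first by rewrite (negbTE nYa) eqxx.
  have := YZE x; rewrite (negbTE Yx) (negbTE xa) (negbTE xb) /= => /norP.
  by case=> /norP[/negbTE-> /negbTE->] /negbTE->; rewrite f2K.
case: (boolP (Y x)) => Yx.
  by have [xa xc] := Yac x Yx; case: F1 => _ _; apply.
have [->//|xa] := eqVneq x a.
have [->|xb] := eqVneq x b; first by rewrite e_sym.
by case: F2 => _ _; apply=> //; apply: contraNneq Yx => ->.
Qed.

End Exchange.

(* Lovasz: the symmetric difference of the two near-factors alternates; it is
   cut at [a c] and [b d] and, if these lie on the same cycle, closed up again
   with [a b] or [b c]. *)
Lemma near_factor_exchange a b c d f1 f2 :
  near_factor e a c f1 -> near_factor e b d f2 -> a != c -> b != d ->
  d != a -> d != c -> e a b -> e b c -> exists f, factor e f.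
Proof.
move=> F1 F2 ac bd da dc eab ebc.
have ba : b != a by apply: contraTneq eab => ->; rewrite e_irr.
have bc : b != c by apply: contraTneq ebc => ->; rewrite e_irr.
pose hits i := (iter i (f2 \o f1) d == a) || (iter i (f2 \o f1) d == c).
have [[i0 h0]|/forallNP nh] := pselect (exists i, hits i); last first.
  by apply: (exchange_avoid F1 F2) => // i; apply/negP/nh.
case: (ex_minnP (ex_intro _ i0 h0)) => k hk kmin.
have nohit i : (i < k)%N -> ~~ hits i.
  by move=> ik; apply/negP => /kmin; lia.
case/orP: hk => /eqP gk; first exact: (exchange_hit F1 F2 ac bd ba bc da dc eab gk).
apply: (exchange_hit (near_factor_sym F1) F2 _ _ _ _ _ _ _ gk) => //.
- by rewrite eq_sym.
- by rewrite e_sym.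
- by move=> i /nohit; rewrite /hits orbC.
Qed.

Lemma switch_factor a c q f : near_factor e a c f -> a != c -> q != a ->
  q != c -> e a q -> e c (f q) -> factor e (switch f a q).
Proof.
move=> F ac qa qc eaq ecq; have [fK fa fe] := F.
have fn x := near_factor_neq x ac F.
have [] := @switchE f a q fK (fn a) (fn q) qa; first by rewrite fa.
rewrite fa => E1 E2 E3 E4 E5.
split=> [|x]; first exact: switchK.
have [->|xa] := eqVneq x a; first by rewrite E1.
have [->|xq] := eqVneq x q; first by rewrite E2 e_sym.
have [->|xc] := eqVneq x c; first by rewrite E3.
have [->|xfq] := eqVneq x (f q); first by rewrite E4 e_sym.
by rewrite E5 //; apply: fe.
Qed.

Lemma switch_near_factor a c p q f : near_factor e a c f -> a != c ->
  p != a -> p != c -> q != a -> q != c -> q != p -> q != f p ->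
  e p q -> e (f p) (f q) -> near_factor e a c (switch f p q).
Proof.
move=> F ac pa pc qa qc qp qfp epq efpq; have [fK fa fe] := F.
have fn x := near_factor_neq x ac F.
have [E1 E2 E3 E4 E5] := @switchE f p q fK (fn p) (fn q) qp qfp.
have [fpa fpc] := near_factor_avoid F pa pc.
have [fqa fqc] := near_factor_avoid F qa qc.
split=> [||x xa xc]; first exact: switchK.
  by rewrite E5 // eq_sym.
have [->|xp] := eqVneq x p; first by rewrite E1.
have [->|xq] := eqVneq x q; first by rewrite E2 e_sym.
have [->|xfp] := eqVneq x (f p); first by rewrite E3.
have [->|xfq] := eqVneq x (f q); first by rewrite E4 e_sym.
by rewrite E5 //; apply: fe.
Qed.

Hypothesis e_nofactor : ~ exists f, factor e f.

Lemma near_factor_universal a c f x : near_factor e a c f -> a != c ->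
  ~~ e a c -> x \in universal e -> (x != a) /\ (x != c).
Proof.
move=> F ac nac /universalP xS; split; apply: contraNneq nac => E.
  by rewrite -E xS // E eq_sym.
by rewrite e_sym -E xS // E.
Qed.

(** If [x] and [f x] were both universal, pairing [a] with [x] and [c] with [f x] would give a
    factor. *)
Lemma near_factor_image_universal a c f x : near_factor e a c f -> a != c ->
  ~~ e a c -> x \in universal e -> f x \notin universal e.
Proof.
move=> F ac nac xS; apply/negP => /universalP fxS.
have [xa xc] := near_factor_universal F ac nac xS.
have [fxa fxc] := near_factor_avoid F xa xc.
move/universalP: xS => xS.
apply: e_nofactor; exists (switch f a x); apply: switch_factor F _ _ _ _ _ => //.
  by rewrite e_sym xS // eq_sym.
by rewrite e_sym fxS // eq_sym.
Qed.

(** Given an edge [a w], one could pair [a] with [w] and [c] with the universal point [f w]. *)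
Lemma near_factor_endpoint a c f w : near_factor e a c f -> a != c ->
  ~~ e a c -> w != a -> w != c -> f w \in universal e -> ~~ e a w.
Proof.
move=> F ac nac wa wc /universalP fwS; apply/negP => eaw.
have [fwa fwc] := near_factor_avoid F wa wc.
apply: e_nofactor; exists (switch f a w); apply: switch_factor F _ _ _ _ _ => //.
by rewrite e_sym fwS // eq_sym.
Qed.

(** [W] consists of [a], [c] and the partners of the universal points, all outside the universal
    set. *)
Lemma independent_set_of_near_factor a c f : near_factor e a c f -> a != c ->
  ~~ e a c -> exists W : {set T},
    [/\ W \subset ~: universal e,
        {in W &, forall v w, ~~ e v w} & (#|universal e| + 2 <= #|W|)%N].
Proof.
set S := universal e => F ac nac; have [fK fa fe] := F.
have Sac x : x \in S -> (x != a) /\ (x != c).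
  exact: near_factor_universal F ac nac.
have fS x : x \in S -> f x \notin S by apply: near_factor_image_universal F ac nac.
set W := [set w | (w \notin S) && ((f w \in S) || (w == a) || (w == c))].
have WE w : w \in W = (w \notin S) && ((f w \in S) || (w == a) || (w == c)).
  by rewrite in_set.
exists W; split.
- by apply/subsetP => w; rewrite in_setC WE => /andP[].
- have nca : ~~ e c a by rewrite e_sym.
  have ca : c != a by rewrite eq_sym.
  have Fs := near_factor_sym F.
  have aW w : (f w \in S) || (w == a) || (w == c) -> ~~ e a w.
    have [->|wa] := eqVneq w a; first by rewrite e_irr.
    have [->//|wc] := eqVneq w c.
    by rewrite !orbF; apply: near_factor_endpoint F ac nac wa wc.
  have cW w : (f w \in S) || (w == a) || (w == c) -> ~~ e c w.
    have [->//|wa] := eqVneq w a.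
    have [->|wc] := eqVneq w c; first by rewrite e_irr.
    by rewrite !orbF; apply: near_factor_endpoint Fs ca nca wc wa.
  move=> v w; rewrite !WE => /andP[vS vW] /andP[wS wW].
  have [->|va] := eqVneq v a; first exact: aW.
  have [->|vc] := eqVneq v c; first exact: cW.
  have [->|wa] := eqVneq w a; first by rewrite e_sym; exact: aW.
  have [->|wc] := eqVneq w c; first by rewrite e_sym; exact: cW.
  move: vW wW; rewrite (negbTE va) (negbTE vc) (negbTE wa) (negbTE wc) !orbF.
  move=> fvS fwS; apply/negP => evw.
  have wv : w != v by apply: contraTneq evw => ->; rewrite e_irr.
  have wfv : w != f v by apply: contraNneq wS => ->.
  have fwfv : f w != f v by rewrite (inj_eq (inv_inj fK)).
  have efvw : e (f v) (f w) by move/universalP: fvS; apply.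
  (* Switching along an edge [v w] would match the two universal points [f v] and [f w]. *)
  have F' := switch_near_factor F ac va vc wa wc wv wfv evw efvw.
  have := near_factor_image_universal F' ac nac fvS.
  have fn x := near_factor_neq x ac F.
  by have [_ _ -> _ _] := switchE fK (fn v) (fn w) wv wfv; rewrite fwS.
- have <- : #|f @: S| = #|S| by apply/card_imset/inv_inj.
  rewrite -[2%N]/(true.+1) -ac -cards2 -cardsUI.
  rewrite (_ : f @: S :&: _ = set0) ?cards0 ?addn0; last first.
    apply/setP => x; rewrite in_setI in_set2 in_set0; apply/negP => /andP[/imsetP[y yS ->]].
    have [ya yc] := Sac y yS.
    by have [/negbTE-> /negbTE->] := near_factor_avoid F ya yc.
  apply/subset_leq_card/subsetP => x; rewrite in_setU in_set2 WE => /orP[/imsetP[y yS ->]|].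
    by rewrite fK yS fS.
  have aS : a \notin S by apply/negP => /Sac[]; rewrite eqxx.
  have cS : c \notin S by apply/negP => /Sac[]; rewrite eqxx.
  by case/orP=> /eqP->; rewrite ?aS ?cS eqxx !orbT.
Qed.

(** [b] has a non-neighbour [d]; if [a c] were missing too, near-factors through [a c] and [b d]
    could be exchanged into a factor. *)
Lemma saturated_trans a b c :
  (forall v w, v != w -> ~~ e v w -> exists f, near_factor e v w f) ->
  b \notin universal e -> e a b -> e b c -> a != c -> e a c.
Proof.
move=> sat bS eab ebc ac; apply: contraT => nac.
have [f1 F1] := sat _ _ ac nac.
have [d bd nbd] : exists2 d, b != d & ~~ e b d.
  move: bS; rewrite inE negb_forall => /existsP[d].
  by rewrite negb_imply eq_sym => /andP[? ?]; exists d.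
have [f2 F2] := sat _ _ bd nbd.
case: e_nofactor; apply: (near_factor_exchange F1 F2) => //.
  by apply: contraNneq nbd => ->; rewrite e_sym.
by apply: contraNneq nbd => ->.
Qed.

End SymmetricRelation.

Lemma saturated_extension e : symmetric e -> irreflexive e ->
  (~ exists f, factor e f) ->
  exists e', [/\ symmetric e', irreflexive e', subrel e e',
    ~ exists f, factor e' f &
    forall v w, v != w -> ~~ e' v w -> exists f, near_factor e' v w f].
Proof.
move=> e_sym e_irr nf.
pose r_of (E : {set T * T}) : rel T := fun x y => (x, y) \in E.
pose P E := `[< [/\ symmetric (r_of E), irreflexive (r_of E) &
                 ~ exists f, factor (r_of E) f] >].
pose C := [set p | e p.1 p.2].
have rC : r_of C = e by apply/funext=> x; apply/funext=> y; rewrite /r_of inE.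
have PC : P C by apply/asboolP; rewrite rC.
have [E Emax CE] := maxset_exists PC.
have /asboolP[Es Ei En] := maxsetp Emax.
exists (r_of E); split=> // [x y exy|a c ac nac].
  by apply: (subsetP CE); rewrite inE.
pose E' := (a, c) |: ((c, a) |: E).
have [f [fK fe]] : exists f, factor (r_of E') f.
  apply: contrapT => nE'; have PE' : P E'.
    apply/asboolP; split=> // [x y|x].
      rewrite /r_of !inE -![((_, _) \in E)]/(r_of E _ _) Es !xpair_eqE.
      by rewrite orbCA [(y == a) && _]andbC [(y == c) && _]andbC.
    rewrite /r_of !inE -[((_, _) \in E)]/(r_of E _ _) Ei !xpair_eqE orbF.
    apply/negP => /orP[] /andP[/eqP-> /eqP E1]; first by rewrite E1 eqxx in ac.
    by rewrite E1 eqxx in ac.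
  have EE' : E \subset E' by rewrite /E' setUA subsetUr.
  by move: nac; rewrite /r_of -(maxsetsup Emax PE' EE') !inE eqxx.
(* A factor of the enlarged relation must use [a c]; otherwise it is already a factor of the maximal
   one. *)
have [fa|fa] := eqVneq (f a) c.
  exists f; split=> // x xa xc; have := fe x.
  by rewrite /r_of !inE !xpair_eqE (negbTE xa) (negbTE xc).
case: En; exists f; split=> // x; have := fe x; rewrite {1}/r_of !inE !xpair_eqE.
case/or3P=> // /andP[/eqP-> /eqP E1]; first by rewrite E1 eqxx in fa.
by rewrite -E1 fK eqxx in fa.
Qed.

End Factor.

(** * From a graph without a factor to a barrier *)

Lemma complete_factor n (e : rel 'I_n) : ~~ odd n ->
  (forall v w, v != w -> e v w) -> exists f, factor e f.
Proof.
move=> n_even ce.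
pose f (i : 'I_n) := insubd i (if odd i then i.-1 else i.+1).
have fE i : nat_of_ord (f i) = if odd i then i.-1 else i.+1.
  rewrite val_insubd; case: ifPn => //; have := ltn_ord i.
  by case: ifPn; lia.
exists f; split=> i.
  apply: val_inj; rewrite /= !fE; case: (nat_of_ord i) => //= k.
  by case: (boolP (odd k)) => /= [-> //|]; case: (odd k).
apply: ce; apply/eqP => /(congr1 (@nat_of_ord n)); rewrite fE.
by case: ifPn; lia.
Qed.

Lemma factor_perfect_matching n (G : sgraph n) f : factor G f ->
  exists M, perfect_matching G M.
Proof.
move=> [fK fe]; exists [set [set x; f x] | x in 'I_n]; apply/and3P; split.
- apply/subsetP => _ /imsetP[x _ ->]; apply/imsetP; exists (x, f x) => //.
  by rewrite inE /= fe.
- apply/trivIsetP => _ _ /imsetP[x _ ->] /imsetP[y _ ->] xy.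
  rewrite -setI_eq0; apply: contraR xy => /set0Pn[z].
  rewrite !inE => /andP[/orP[]/eqP-> /orP[]/eqP E].
  + by rewrite E.
  + by rewrite E fK setUC.
  + by rewrite -E fK setUC.
  + by rewrite (inv_inj fK E).
- apply/eqP/setP => x; rewrite inE; apply/bigcupP; exists [set x; f x].
    exact: imset_f.
  by rewrite !inE eqxx.
Qed.

Lemma tutte_barrier n (G : sgraph n) : ~~ odd n -> connected G ->
  (~ exists f, factor G f) ->
  exists (e : rel 'I_n) (W : {set 'I_n}),
    [/\ symmetric e, irreflexive e & subrel G e] /\
    [/\ (forall u v w, v \notin universal e -> e u v -> e v w -> u != w -> e u w),
        W \subset ~: universal e, {in W &, forall v w, ~~ e v w},
        (#|universal e| + 2 <= #|W|)%N & (0 < #|universal e|)%N].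
Proof.
move=> n_even G_conn nf.
have [e [e_sym e_irr Ge e_nf sat]] :=
  saturated_extension (@adj_sym _ G) (@adj_irr _ G) nf.
have [a [c [ac nac]]] : exists a c, a != c /\ ~~ e a c.
  apply: contrapT => H; apply: e_nf; apply: complete_factor => // v w vw.
  by apply: contraT => nvw; case: H; exists v, w.
have [f F] := sat _ _ ac nac.
have [W [WS Wi cW]] := independent_set_of_near_factor e_sym e_irr e_nf F ac nac.
have tr u v w : v \notin universal e -> e u v -> e v w -> u != w -> e u w.
  exact: (saturated_trans e_sym e_irr e_nf sat).
exists e, W; split=> //; split=> //.
(* Without universal points, [e] is transitive on distinct points, so connectivity of [G] would make
   [a] and [c] adjacent. *)
apply: contraNT nac; rewrite -eqn0Ngt cards_eq0 => /eqP S0.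
have conn p u : path G u p -> (last u p == u) || e u (last u p).
  elim: p u => [|v p IH] u /=; first by rewrite eqxx.
  case/andP=> /Ge euv /IH /orP[/eqP->|evl]; first by rewrite euv orbT.
  have [//|lu] := eqVneq (last v p) u.
  by apply: (tr u v) => //; rewrite ?S0 ?inE // eq_sym.
have /connectP[p /conn + cE] := G_conn a c.
by rewrite -cE eq_sym (negbTE ac).
Qed.

(** * The cliques of H - S *)

Definition block n (e : rel 'I_n) v :=
  [set w | (w \notin universal e) && ((w == v) || e v w)].

Section Blocks.
Variables (n : nat) (e : rel 'I_n).
Hypotheses (e_sym : symmetric e) (e_irr : irreflexive e).
Hypothesis e_trans : forall u v w,
  v \notin universal e -> e u v -> e v w -> u != w -> e u w.
Notation S := (universal e).

Lemma in_block v w :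
  (w \in block e v) = (w \notin S) && ((w == v) || e v w).
Proof. by rewrite in_set. Qed.

Lemma block_refl v : v \notin S -> v \in block e v.
Proof. by move=> vS; rewrite in_block vS eqxx. Qed.

Lemma block_sub v w : v \notin S -> w \in block e v ->
  block e v \subset block e w.
Proof.
rewrite in_block => vS /andP[wS /orP[/eqP->//|evw]].
apply/subsetP => u; rewrite !in_block => /andP[-> /=].
have [//|uw] := eqVneq u w; case/orP=> [/eqP->|evu]; first by rewrite e_sym.
by apply: (e_trans vS) => //; [rewrite e_sym | rewrite eq_sym].
Qed.

Lemma block_eq v w : v \notin S -> w \in block e v -> block e w = block e v.
Proof.
move=> vS wv; apply/eqP; rewrite eqEsubset (block_sub vS wv) andbT.
move: wv; rewrite in_block => /andP[wS wv].
by apply: block_sub => //; rewrite in_block vS eq_sym e_sym.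
Qed.

Variable W : {set 'I_n}.
Hypotheses (WS : W \subset ~: S) (W_indep : {in W &, forall v w, ~~ e v w}).

Lemma block_independent v : v \notin S ->
  {in W &, forall u w, u \in block e v -> w \in block e v -> u = w}.
Proof.
move=> vS u w uW wW uv wv; apply: contraNeq (W_indep uW wW) => uw.
have : w \in block e u by rewrite (block_eq vS).
by rewrite in_block eq_sym (negbTE uw) => /andP[].
Qed.

(** The block and [W] lie outside S and share at most one point. With at least s + 2 points in [W]
    this yields the bound M = n - 2s - 1. *)
Lemma card_block v : v \notin S -> (#|block e v| + #|W| <= n - #|S| + 1)%N.
Proof.
move=> vS; rewrite -cardsUI; apply: leq_add.
  rewrite (_ : (n - #|S|)%N = #|~: S|); last by rewrite [RHS]cardsCs setCK card_ord.
  apply: subset_leq_card.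
  by rewrite subUset WS andbT; apply/subsetP => w; rewrite in_block in_setC => /andP[].
apply/card_le1_eqP => u w; rewrite !in_setI => /andP[uv uW] /andP[wv wW].
exact: (block_independent vS).
Qed.

End Blocks.

Local Open Scope ring_scope.

(** * Eigenvalue bounds from positive test vectors *)

Section Spectrum.
Variable R : realType.

Lemma mul_signless_laplacian n (G : sgraph n) (y : 'rV[R]_n) v :
  (y *m signless_laplacian R G) 0 v = \sum_(w | G v w) (y 0 v + y 0 w).
Proof.
rewrite mulmxDr mxE big_split /= sumr_const -mulr_natr; congr (_ + _).
  rewrite mxE (bigD1 v) //= big1 ?addr0 => [|w wv].
    by rewrite !mxE eqxx mulr1n.
  by rewrite !mxE (negbTE wv) mulr0n mulr0.
rewrite mxE [RHS]big_mkcond; apply: eq_bigr => w _; rewrite mxE (adj_sym G).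
by case: (G v w); rewrite ?mulr1 ?mulr0.
Qed.

(* Pairing [x] with the absolute value of an eigenvector. *)
Lemma eigenvalue_le n (G : sgraph n) (x : 'I_n -> R) rho lambda :
  (forall v, 0 < x v) ->
  (forall v, \sum_(w | G v w) (x v + x w) <= rho * x v) ->
  eigenvalue (signless_laplacian R G) lambda -> lambda <= rho.
Proof.
move=> x0 xrho /eigenvalueP[y yl y0].
have yE v : lambda * y 0 v = \sum_(w | G v w) (y 0 v + y 0 w).
  by rewrite -mul_signless_laplacian yl mxE.
have pos : 0 < \sum_v x v * `|y 0 v|.
  have [v yv] : exists v, y 0 v != 0.
    apply/existsP; apply: contraNT y0; rewrite negb_exists => /forallP y0.
    by apply/eqP/rowP => v; rewrite mxE; apply/eqP; rewrite -[_ == _]negbK.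
  rewrite (bigD1 v) //= ltr_pwDl //; first by rewrite mulr_gt0 ?normr_gt0.
  by apply: sumr_ge0 => w _; rewrite mulr_ge0 // ltW.
rewrite -(ler_pM2r pos) !mulr_sumr.
(* Adjacency is symmetric, so the two ends of an edge may be exchanged in a double sum. *)
have sumE (z : 'I_n -> 'I_n -> R) : \sum_v \sum_(w | G v w) z v w =
    \sum_v \sum_(w | G v w) z w v.
  rewrite (exchange_big_dep predT) //=; apply: eq_bigr => w _.
  by apply: eq_bigl => v; rewrite (adj_sym G).
apply: (@le_trans _ _ (\sum_v \sum_(w | G v w) (`|y 0 v| * x v + `|y 0 w| * x v))).
  apply: ler_sum => v _; rewrite mulrCA [leLHS]mulrC.
  rewrite (_ : \sum_(w | _) _ = (\sum_(w | G v w) (`|y 0 v| + `|y 0 w|)) * x v);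
    last by rewrite mulr_suml; apply: eq_bigr => w _; rewrite mulrDl.
  rewrite ler_pM2r //; apply: (@le_trans _ _ `|lambda * y 0 v|).
    by rewrite normrM ler_wpM2r // ler_norm.
  rewrite yE; apply: (le_trans (ler_norm_sum _ _ _)).
  by apply: ler_sum => w _; apply: ler_normD.
have -> : \sum_v \sum_(w | G v w) (`|y 0 v| * x v + `|y 0 w| * x v) =
    \sum_v `|y 0 v| * \sum_(w | G v w) (x v + x w).
  under eq_bigr do rewrite big_split /=.
  rewrite big_split /= [X in _ + X]sumE -big_split /=; apply: eq_bigr => v _.
  by rewrite mulr_sumr -big_split /=; apply: eq_bigr => w _; rewrite mulrDr.
by apply: ler_sum => v _; rewrite [leRHS]mulrA [leRHS]mulrC ler_wpM2l.
Qed.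

(** The function m / (c - 2m) is convex, hence lies below its chord between 1 and [M]; the
    right-hand side is that chord divided by [m]. *)
Lemma inv_chord (c m M : R) : 1 <= m -> m <= M -> 0 < c - 2 * M ->
  (c - 2 * m)^-1 <= c / ((c - 2 * M) * (c - 2)) -
    (c / ((c - 2 * M) * (c - 2)) - (c - 2)^-1) / m.
Proof.
move=> m1 mM cM.
have m0 : 0 < m by lra.
have cm : 0 < c - 2 * m by lra.
have c2 : 0 < c - 2 by lra.
(* The chord from 1 to [m] gives equality at [m]; replacing [m] by [M] in its slope only raises the
   value. *)
have -> : (c - 2 * m)^-1 =
    c / ((c - 2 * m) * (c - 2)) - (c / ((c - 2 * m) * (c - 2)) - (c - 2)^-1) / m.
  by field; rewrite !gt_eqF.
have le : c / ((c - 2 * m) * (c - 2)) <= c / ((c - 2 * M) * (c - 2)).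
  rewrite ler_wpM2l //; first by lra.
  rewrite lef_pV2 ?posrE ?mulr_gt0 // ler_wpM2r; lra.
set p := c / _ in le *; set q := c / _ in le *.
rewrite -subr_ge0 (_ : _ - _ = (q - p) * (1 - m^-1)); last by ring.
by rewrite mulr_ge0 ?subr_ge0 // invf_le1.
Qed.

(** * The test vector attached to a barrier *)

Section Barrier.
Variables (n : nat) (e : rel 'I_n) (W : {set 'I_n}).
Hypotheses (e_sym : symmetric e) (e_irr : irreflexive e).
Notation S := (universal e).
Hypothesis e_trans : forall u v w, v \notin S -> e u v -> e v w -> u != w -> e u w.
Hypotheses (WS : W \subset ~: S) (W_indep : {in W &, forall v w, ~~ e v w}).
Hypotheses (cardW : (#|S| + 2 <= #|W|)%N) (S_gt0 : (0 < #|S|)%N).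

Notation m v := (#|block e v|).

Lemma card_block_gt0 v : v \notin S -> (0 < m v)%N.
Proof. by move=> vS; apply/card_gt0P; exists v; apply: block_refl. Qed.

Lemma in_block_sym v w : v \notin S -> w \notin S ->
  (v \in block e w) = (w \in block e v).
Proof. by move=> vS wS; rewrite !in_block vS wS eq_sym e_sym. Qed.

(** Each clique contributes 1 to the sum, which therefore counts the cliques; the points of [W] lie
    in distinct ones. *)
Lemma sum_inv_card_block : #|W|%:R <= \sum_(v | v \notin S) (m v)%:R^-1 :> R.
Proof.
have WnS w : w \in W -> w \notin S by move=> /(subsetP WS); rewrite in_setC.
apply: (@le_trans _ _
    (\sum_(v | v \notin S) \sum_(w in W :&: block e v) (m v)%:R^-1)).
  rewrite (exchange_big_dep (mem W)) /=; last first.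
    by move=> v w _; rewrite in_setI => /andP[].
  rewrite -sum1_card natr_sum; apply: ler_sum => w wW.
  have wS := WnS w wW.
  rewrite (eq_bigl (mem (block e w))) /=; last first.
    move=> v; rewrite in_setI wW /=; case: (boolP (v \in S)) => vS /=.
      by rewrite [RHS]in_block vS.
    by rewrite in_block_sym.
  rewrite (eq_bigr (fun=> (m w)%:R^-1)); last first.
    by move=> v vw; rewrite (block_eq e_sym e_trans wS vw).
  by rewrite sumr_const -[leRHS]mulr_natl mulfV // pnatr_eq0 -lt0n card_block_gt0.
apply: ler_sum => v vS; rewrite sumr_const -[leLHS]mulr_natl ler_piMl ?invr_ge0 //.
rewrite lern1; apply/card_le1_eqP => u w; rewrite !in_setI.
move=> /andP[uW uv] /andP[wW wv].
exact: (block_independent e_sym e_trans W_indep vS).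
Qed.

Variable rho : R.
Let s : R := #|S|%:R.
Let c := rho - s + 2.
Let M : R := n%:R - 2 * s - 1.
Hypothesis cM : 0 < c - 2 * M.
Hypothesis rho_ge : s * ((s + 1) / (c - 2) + M / (c - 2 * M)) <= rho - (n%:R - 2 + s).

Let s_gt0 : 0 < s. Proof. by rewrite /s ltr0n. Qed.

Lemma card_block_bounds v : v \notin S -> (1 : R) <= (m v)%:R /\ (m v)%:R <= M.
Proof.
move=> vS; rewrite ler1n card_block_gt0 //; split=> //.
have := card_block e_sym e_trans WS W_indep vS.
have := card_block_gt0 vS; have := cardW; have := max_card (mem S).
rewrite card_ord -[X in (X <= n)%N]/(#|S|) => h1 h2 h3 h4.
have : (m v + (#|S| + #|S|) + 1 <= n)%N by lia.
by rewrite -(ler_nat R) !natrD /M /s; lra.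
Qed.

(** The value x off S solves [s * (x + 1) + 2 * (m - 1) * x = rho * x], the eigenvalue equation on a
    clique of size m. *)
Definition barrier_vector v : R :=
  if v \in S then 1 else s / (c - 2 * (m v)%:R).

Lemma barrier_vector_gt0 v : 0 < barrier_vector v.
Proof.
rewrite /barrier_vector; case: ifPn => // vS; have [m1 mM] := card_block_bounds vS.
apply: divr_gt0 => //; have := cM; lra.
Qed.

Lemma card_notin_universal : #|[pred v | v \notin S]|%:R = n%:R - s :> R.
Proof.
apply/eqP; rewrite eq_sym subr_eq /s -natrD eqr_nat.
by rewrite -{1}(card_ord n) addnC -(cardC (mem S)).
Qed.

(** By [inv_chord] each entry is bounded by an affine function of 1/m, so the total bound depends
    only on the number of cliques and does not increase with it. *)
Lemma sum_barrier_vector :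
  \sum_(v | v \notin S) barrier_vector v <= rho - (n%:R - 2 + s).
Proof.
apply: le_trans rho_ge.
rewrite (eq_bigr (fun v => s * (c - 2 * (m v)%:R)^-1)); last first.
  by move=> v; rewrite /barrier_vector => /negbTE->.
rewrite -mulr_sumr; apply: ler_wpM2l; first exact: ltW.
have [v0 v0S] : exists v, v \notin S.
  have /card_gt0P[w wW] : (0 < #|W|)%N by apply: leq_trans cardW; rewrite addn2.
  by exists w; have /(subsetP WS) := wW; rewrite in_setC.
have [m1 mM] := card_block_bounds v0S.
have M1 : 1 <= M by lra.
pose B := c / ((c - 2 * M) * (c - 2)).
have c2 : 0 < c - 2 by have := cM; lra.
have Bg : 0 <= B - (c - 2)^-1.
  have -> : B - (c - 2)^-1 = 2 * M / ((c - 2 * M) * (c - 2)).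
    by rewrite /B; field; rewrite !gt_eqF.
  by rewrite divr_ge0 ?mulr_ge0 //; have := cM; lra.
apply: (@le_trans _ _ (\sum_(v | v \notin S) (B - (B - (c - 2)^-1) * (m v)%:R^-1))).
  by apply: ler_sum => v /card_block_bounds[? ?]; apply: inv_chord.
have sumB : \sum_(v | v \notin S) B = (n%:R - s) * B.
  by rewrite sumr_const -card_notin_universal mulr_natl.
rewrite sumrB sumB -mulr_sumr.
have := sum_inv_card_block; set t := \sum_(_ | _) _ => Wt.
have st : s + 2 <= t.
  by apply: le_trans Wt; rewrite /s -natrD ler_nat.
(* The chord is exact at sizes 1 and [M], so s + 2 cliques give exactly one of size [M] and s + 1
   single points. *)
have -> : (s + 1) / (c - 2) + M / (c - 2 * M) =
    (n%:R - s) * B - (B - (c - 2)^-1) * (s + 2).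
  by rewrite (_ : n%:R - s = M + s + 1) /B; [field; rewrite !gt_eqF|rewrite /M; ring].
by rewrite lerD2l lerN2 ler_wpM2l.
Qed.

Lemma barrier_vector_le v :
  \sum_(w | e v w) (barrier_vector v + barrier_vector w) <= rho * barrier_vector v.
Proof.
have xS w : w \in S -> barrier_vector w = 1 by rewrite /barrier_vector => ->.
have eS w u : w \in S -> e w u = (u != w).
  move=> wS; apply/idP/idP; last exact: (universalP _ _ wS).
  by apply: contraTneq => ->; rewrite e_irr.
case: (boolP (v \in S)) => vS.
  (* At a vertex of S the row sum is n - 2 + s plus the total weight off S. *)
  rewrite (xS v vS) (eq_bigl _ _ (fun w => eS v w vS)).
  have : \sum_w (1 + barrier_vector w) =
      1 + 1 + \sum_(w | w != v) (1 + barrier_vector w).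
    by rewrite (bigD1 v) //= (xS v vS).
  rewrite big_split /= sumr_const card_ord (bigID (mem S)) /=.
  have -> : \sum_(w in S) barrier_vector w = s.
    by rewrite (eq_bigr (fun=> 1)) // sumr_const.
  move=> sumE; have le := sum_barrier_vector.
  lra.
have [m1 mM] := card_block_bounds vS.
have xv : barrier_vector v = s / (c - 2 * (m v)%:R).
  by rewrite /barrier_vector (negbTE vS).
rewrite (bigID (mem S)) /= (eq_bigr (fun=> barrier_vector v + 1)); last first.
  by move=> w /andP[_ wS]; rewrite (xS w wS).
rewrite (eq_bigl (mem S)) /=; last first.
  move=> w; apply/andP/idP => [[]//|/= wS]; split=> //.
  by rewrite e_sym (eS _ _ wS); apply: contraNneq vS => ->.
(* The sum over the whole block also counts [w = v]; [bigD1] splits that term off below. *)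
have : \sum_(w in block e v) (barrier_vector v + barrier_vector w) =
    (m v)%:R * (barrier_vector v + barrier_vector v).
  rewrite (eq_bigr (fun=> barrier_vector v + barrier_vector v)).
    by rewrite sumr_const mulr_natl.
  move=> w wv; congr (_ + _); rewrite /barrier_vector (negbTE vS).
  have /andP[/negbTE-> _] : (w \notin S) && ((w == v) || e v w) by rewrite -in_block.
  by rewrite (block_eq e_sym e_trans vS wv).
rewrite (bigD1 v) ?block_refl //=.
rewrite [X in _ + X = _](eq_bigl (fun w => e v w && (w \notin S))); last first.
  move=> w; rewrite in_block; have [->|_] := eqVneq w v.
    by rewrite e_irr andbF.
  by rewrite andbT andbC.
rewrite sumr_const -(mulr_natl (barrier_vector v + 1)) -/s.
have : (c - 2 * (m v)%:R) * barrier_vector v = s.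
  by rewrite xv mulrC divfK // gt_eqF //; have := cM; lra.
rewrite /c => xE sumE.
lra.
Qed.

End Barrier.

(** The condition [0 <= rho] covers the default value of [largest]. *)
Lemma q1_le n (G : sgraph n) rho : 0 <= rho ->
  (forall lambda, eigenvalue (signless_laplacian R G) lambda -> lambda <= rho) ->
  q1 R G <= rho.
Proof.
by move=> rho0 le; rewrite /q1 /largest; case: classical_sets.xgetP => // y _ [/le].
Qed.

(* The spectral radius is controlled by [rho] as soon as it is for the join of
   [K_s] with [K_M] and [s + 1] isolated vertices. *)
Lemma q1_barrier n (G : sgraph n) : ~~ odd n -> connected G ->
  ~ (exists f, factor G f) ->
  exists2 s : nat, ((1 <= s) && (2 * s + 2 <= n))%N & forall rho : R,
    let M : R := n%:R - 2 * s%:R - 1 in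
    0 < rho - s%:R + 2 - 2 * M ->
    s%:R * ((s%:R + 1) / (rho - s%:R) + M / (rho - s%:R + 2 - 2 * M))
      <= rho - (n%:R - 2 + s%:R) ->
    q1 R G <= rho.
Proof.
move=> n_even G_conn nf.
have [e [W [[e_sym e_irr Ge] [e_tr WS Wi cW S0]]]] := tutte_barrier n_even G_conn nf.
have Sn : (2 * #|universal e| + 2 <= n)%N.
  have : (#|universal e| + 2 <= #|~: universal e|)%N.
    exact: leq_trans cW (subset_leq_card WS).
  by have := cardsC (universal e); rewrite card_ord; lia.
exists #|universal e|; first by rewrite S0.
move=> rho M cM le.
have M1 : 1 <= M.
  by move: Sn; rewrite -(ler_nat R) natrD natrM /M; lra.
have le' : #|universal e|%:R * ((#|universal e|%:R + 1) / (rho - #|universal e|%:R + 2 - 2)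
    + M / (rho - #|universal e|%:R + 2 - 2 * M)) <= rho - (n%:R - 2 + #|universal e|%:R).
  by rewrite addrK.
have x0 := barrier_vector_gt0 e_sym e_tr WS Wi cW S0 cM le'.
apply: q1_le; first by move: cM S0; rewrite -(ltr0n R); lra.
move=> lambda ev; apply: (eigenvalue_le x0 _ ev) => v.
(* The entries are positive and [G] is a subgraph of [e], so passing to [e] only adds nonnegative
   terms. *)
apply: le_trans (barrier_vector_le e_sym e_irr e_tr WS Wi cW S0 cM le' v).
rewrite big_mkcond [leRHS]big_mkcond /=; apply: ler_sum => w _.
case: (boolP (G v w)) => [/Ge->//|_]; case: ifP => // _.
by rewrite addr_ge0 // ltW.
Qed.

(** * The largest root of the cubic *)

Definition cubic (n : nat) (x : R) :=
  x ^+ 3 - (3 * n%:R - 7) * x ^+ 2 + n%:R * (2 * n%:R - 7) * x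
    - 2 * (n%:R ^+ 2 - 7 * n%:R + 12).

Lemma exists_greatest_root (p : {poly R}) a : p != 0 -> root p a ->
  exists2 b, root p b & forall x, root p x -> x <= b.
Proof.
move: {2}(size p) (leqnn (size p)) => k.
elim: k p a => [|k IH] p a; first by rewrite leqn0 size_poly_eq0 => /eqP->; rewrite eqxx.
move=> pk p0 /factor_theorem[q pE].
have q0 : q != 0 by apply: contraNneq p0 => q0; rewrite pE q0 mul0r.
have pr x : root p x = root q x || (x == a) by rewrite pE rootM root_XsubC.
have [[c qc]|nq] := pselect (exists c, root q c).
  have qk : (size q <= k)%N.
    by rewrite -ltnS; apply: leq_trans pk; rewrite pE size_Mmonic ?monicXsubC ?size_XsubC ?addn2.
  have [b qb bmax] := IH q c qk q0 qc.
  have [ab|ba] := leP a b.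
    exists b => [|x]; rewrite pr ?qb //.
    by case/orP=> [/bmax//|/eqP->].
  exists a => [|x]; rewrite pr ?eqxx ?orbT //.
  by case/orP=> [/bmax xb|/eqP->//]; apply: le_trans xb (ltW ba).
exists a => [|x]; rewrite pr ?eqxx ?orbT // => /orP[qx|/eqP->//].
by case: nq; exists x.
Qed.

(** A sign change between [a] and 3n gives a root that is at least [a]; since a greatest root
    exists, [largest] returns it and not its default. *)
Lemma r_spec n a : (4 <= n)%N -> a <= 3 * n%:R -> cubic n a <= 0 ->
  a <= r R n /\ cubic n (r R n) = 0.
Proof.
move=> n4 an ca.
pose p : {poly R} := 'X^3 - (3 * n%:R - 7)%:P * 'X^2
  + (n%:R * (2 * n%:R - 7))%:P * 'X - (2 * (n%:R ^+ 2 - 7 * n%:R + 12))%:P.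
have pE x : p.[x] = cubic n x.
  by rewrite /p !(hornerD, hornerN, hornerM, hornerC, hornerX, hornerXn).
have N4 : 4 <= n%:R :> R by rewrite ler_nat.
have pb : 0 < p.[3 * n%:R] by rewrite pE /cubic; nra.
have p0 : p != 0 by apply: contraTneq pb => ->; rewrite horner0 ltxx.
have pab : p.[a] <= 0 <= p.[3 * n%:R] by rewrite pE ca ltW.
have [c /andP[ac _] pc] := poly_ivt an pab.
have [b pb' bmax] := exists_greatest_root p0 pc.
have rootE x : root p x = (cubic n x == 0) by rewrite rootE pE.
rewrite /r /largest; case: classical_sets.xgetP => [x _ [xr xmax]|/(_ b) nb].
  by split=> //; apply: (le_trans ac); apply: xmax; apply/eqP; rewrite -[_ == _]rootE.
case: nb; split; first by apply/eqP; rewrite -[_ == _]rootE.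
by move=> y /eqP; rewrite -[_ == _]rootE => /bmax.
Qed.

(** * Checking the barrier condition for each n *)

Lemma barrier_mono (s M A B C A0 B0 C0 : R) : 0 <= s -> 0 <= M ->
  0 < A0 -> A0 <= A -> 0 < B0 -> B0 <= B -> C0 <= C ->
  s * ((s + 1) * B0 + M * A0) <= C0 * A0 * B0 ->
  s * ((s + 1) / A + M / B) <= C.
Proof.
move=> s0 M0 A0p AA B0p BB CC le.
apply: le_trans CC; apply: (@le_trans _ _ (s * ((s + 1) / A0 + M / B0))).
  rewrite ler_wpM2l // lerD // ler_wpM2l ?addr_ge0 // lef_pV2 // posrE.
    exact: lt_le_trans AA.
  exact: lt_le_trans BB.
rewrite (_ : s * _ = s * ((s + 1) * B0 + M * A0) / (A0 * B0)); last first.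
  by field; rewrite !gt_eqF.
by rewrite ler_pdivrMr ?mulr_gt0 // mulrA.
Qed.

(** The barrier condition at rho = 2n - 6 with n = M + 2s + 1 and denominators cleared. The cases
    are the pairs with s > 1 and n >= 10 other than (n, s) = (10, 4). *)
Lemma barrier_poly (s M : R) :
  [\/ s = 2 /\ 5 <= M, s = 3 /\ 3 <= M, s = 4 /\ 3 <= M | 5 <= s /\ 1 <= M] ->
  s * ((s + 1) * (3 * s - 2) + M * (2 * M + 3 * s - 4)) <=
  (M + s - 3) * (2 * M + 3 * s - 4) * (3 * s - 2).
Proof.
case=> [[-> M5]|[-> M3]|[-> M3]|[s5 M1]]; [nra|nra|nra|].
pose x := s - 5; pose y := M - 1.
have -> : s = x + 5 by rewrite /x; ring.
have -> : M = y + 1 by rewrite /y; ring.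
have x0 : 0 <= x by rewrite subr_ge0.
have y0 : 0 <= y by rewrite subr_ge0.
have xy := mulr_ge0 x0 y0; have xx := mulr_ge0 x0 x0.
have yy := mulr_ge0 y0 y0; have xxx := mulr_ge0 x0 xx.
have xxy := mulr_ge0 x0 xy; have xyy := mulr_ge0 x0 yy.
nra.
Qed.

Lemma no_factor_q1_le6 (G : sgraph 6) : connected G -> ~ (exists f, factor G f) ->
  q1 R G <= 4 + 2 * Num.sqrt 3.
Proof.
move=> G_conn nf; have [s s12 bound] := q1_barrier (erefl : ~~ odd 6) G_conn nf.
set t := Num.sqrt 3.
have t0 : 0 <= t by apply: sqrtr_ge0.
have tt : t * t = 3 by rewrite -expr2 sqr_sqrtr.
have t1 : 17 / 10 <= t by nra.
have [s1|s2] : s = 1%N \/ s = 2%N by lia.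
  rewrite s1 in bound; apply: bound; first by lra.
  by apply: (barrier_mono (A0 := 6) (B0 := 2) (C0 := 2)); lra.
rewrite s2 in bound; apply: bound; first by lra.
(* Here [M = 1] and the condition reads 8 <= (2t - 2)(2t + 2), an equality; this fixes the constant
   for n = 6. *)
apply: (barrier_mono (A0 := (2 + 2 * t)) (B0 := (2 + 2 * t)) (C0 := (2 * t - 2))); nra.
Qed.

Lemma no_factor_q1_le8 (G : sgraph 8) : connected G -> ~ (exists f, factor G f) ->
  q1 R G <= 6 + 2 * Num.sqrt 6.
Proof.
move=> G_conn nf; have [s s13 bound] := q1_barrier (erefl : ~~ odd 8) G_conn nf.
set t := Num.sqrt 6.
have t0 : 0 <= t by apply: sqrtr_ge0.
have tt : t * t = 6 by rewrite -expr2 sqr_sqrtr.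
have t1 : 24 / 10 <= t by nra.
have [s1|[s2|s3]] : s = 1%N \/ s = 2%N \/ s = 3%N by lia.
- rewrite s1 in bound; apply: bound; first by lra.
  by apply: (barrier_mono (A0 := (98 / 10)) (B0 := (18 / 10)) (C0 := (38 / 10))); lra.
- rewrite s2 in bound; apply: bound; first by lra.
  by apply: (barrier_mono (A0 := 8) (B0 := 4) (C0 := 5 / 2)); lra.
- rewrite s3 in bound; apply: bound; first by lra.
  (* Again [M = 1]: 15 <= (2t - 3)(2t + 3) is an equality, which fixes the constant for n = 8. *)
  apply: (barrier_mono (A0 := (3 + 2 * t)) (B0 := (3 + 2 * t)) (C0 := (2 * t - 3))); nra.
Qed.

Lemma r_ge n : (4 <= n)%N -> 2 * n%:R - 6 <= r R n /\ cubic n (r R n) = 0.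
Proof.
move=> n4; have N4 : 4 <= n%:R :> R by rewrite ler_nat.
apply: (r_spec n4); first by lra.
by rewrite (_ : cubic _ _ = 12 - 4 * n%:R); [lra | rewrite /cubic; ring].
Qed.

(** 43/3 is a rational number just above 8 + 2 sqrt 10, the threshold of the barrier condition for n
    = 10 and s = 4. *)
Lemma r10_ge : 43 / 3 <= r R 10.
Proof. by apply: (proj1 (r_spec _ _ _)) => //; rewrite ?/cubic; lra. Qed.

Lemma no_factor_q1_le_r n (G : sgraph n) : ~~ odd n -> (n == 4) || (10 <= n)%N ->
  connected G -> ~ (exists f, factor G f) -> q1 R G <= r R n.
Proof.
move=> n_even nE G_conn nf; have [s /andP[s1 sn] bound] := q1_barrier n_even G_conn nf.
have n4 : (4 <= n)%N by lia.
have N4 : 4 <= n%:R :> R by rewrite ler_nat.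
have [rn r_root] := r_ge n4.
have s1' : 1 <= s%:R :> R by rewrite ler1n.
have sn' : 2 * s%:R + 2 <= n%:R :> R by rewrite -natrM -natrD ler_nat.
apply: bound; first by lra.
have [s_eq1|s2] : s = 1%N \/ (2 <= s)%N by lia.
  (* For s = 1 the cleared inequality is an equality, namely the cubic equation at r(n). *)
  rewrite s_eq1; apply: (barrier_mono (A0 := r R n - 1) (B0 := r R n + 7 - 2 * n%:R)
    (C0 := r R n - (n%:R - 1))); try lra.
  by move: r_root; rewrite /cubic; lra.
(* For n = 4 only s = 1 is possible, so n >= 10 from here on. *)
have n10 : (10 <= n)%N by lia.
have [[n_eq10 s4]|ns] : (n = 10 /\ s = 4)%N \/ (n = 10 /\ s <= 3 \/ 12 <= n)%N by lia.
  have := r10_ge; rewrite n_eq10 s4 => r10.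
  by apply: (barrier_mono (A0 := 31 / 3) (B0 := 31 / 3) (C0 := 7 / 3)); lra.
pose M : R := n%:R - 2 * s%:R - 1.
have MN k : (2 * s + 1 + k <= n)%N -> k%:R <= M.
  by rewrite -(ler_nat R) 2!natrD natrM /M; lra.
apply: (barrier_mono (A0 := 2 * M + 3 * s%:R - 4) (B0 := 3 * s%:R - 2)
  (C0 := M + s%:R - 3)); rewrite -/M; try (rewrite /M; lra).
apply: barrier_poly.
have [s_eq|[s_eq|[s_eq|s5]]] : (s = 2 \/ s = 3 \/ s = 4 \/ 5 <= s)%N by lia.
- by constructor 1; split; [rewrite s_eq | apply: (MN 5%N); lia].
- by constructor 2; split; [rewrite s_eq | apply: (MN 3%N); lia].
- by constructor 3; split; [rewrite s_eq | apply: (MN 3%N); lia].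
- by constructor 4; split; [rewrite ler_nat | apply: (MN 1%N); lia].
Qed.

End Spectrum.

Theorem theorem1p2 (R : realType) (n : nat) (G : sgraph n)
    (n_ge4 : (4 <= n)%N) (n_even : ~~ odd n) (G_conn : connected G)
    (q1_gt : (if n == 6%N then 4 + 2 * Num.sqrt 3
              else if n == 8%N then 6 + 2 * Num.sqrt 6
              else r R n) < q1 R G) :
  exists M : {set {set 'I_n}}, perfect_matching G M.
Proof.
have [[f]|nf] := pselect (exists f, factor G f).
  exact: factor_perfect_matching.
move: q1_gt; case: ifPn => [/eqP n6|n6]; last case: ifPn => [/eqP n8|n8].
- by subst n; rewrite ltNge no_factor_q1_le6.
- by subst n; rewrite ltNge no_factor_q1_le8.
- by rewrite ltNge no_factor_q1_le_r //; lia.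
Qed.
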